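(* Let $k$ be a field and let $T$ be a totally ordered set. There is a homeomorphism $$\operatorname{Sp}\operatorname{Mod} kT \longrightarrow \operatorname{Idl} T$$ between the spectrum of $\operatorname{Mod} kT$ (with the Ziegler topology) and the space $\operatorname{Idl} T$ of ideals of $T$ equipped with the order topology.
   Context: $\operatorname{Mod} kT$ is the category of $k$-linear representations of $T$, i.e. of functors from $T$ (viewed as a category with a unique morphism $x\to y$ whenever $x\le y$) to $k$-vector spaces. For $x\in T$, let $h^x=k_{[x,\infty)}$ be the representation with value $k$ at all $t\ge x$ and $0$ elsewhere, with identity structure maps where possible. $\operatorname{mod} kT$ is the full subcategory of finitely presented objects, i.e. of those $M$ admitting an exact sequence $\bigoplus_{i=1}^m h^{x_i}\to\bigoplus_{j=1}^n h^{y_j}\to M\to 0$; this is an abelian category. Spectrum: $\operatorname{Sp}\operatorname{Mod} kT$ is a set of representatives of the isomorphism classes of indecomposable injective objects of $\operatorname{Mod} kT$. The Ziegler topology on it is given by the Kuratowski closure operator $\mathcal U\mapsto \overline{\mathcal U}=({}^{\perp}\mathcal U)^{\perp}$, where for $\mathcal U\subseteq\operatorname{Sp}\operatorname{Mod} kT$ and a class $\mathcal C$ of objects of $\operatorname{mod} kT$, ${}^{\perp}\mathcal U=\{C\in\operatorname{mod} kT\mid \operatorname{Hom}(C,X)=0\text{ for all }X\in\mathcal U\}$ and $\mathcal C^{\perp}=\{X\in\operatorname{Sp}\operatorname{Mod} kT\mid \operatorname{Hom}(C,X)=0\text{ for all }C\in\mathcal C\}$. Ideals: an ideal of $T$ is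 a nonempty subset $I\subseteq T$ such that $x\le y$ and $y\in I$ imply $x\in I$. $\operatorname{Idl} T$ is the set of all ideals of $T$, totally ordered by inclusion. The order topology on a totally ordered set $S$ is generated by the subbasis of open rays $\{b\in S\mid b>a\}$ and $\{b\in S\mid b<a\}$ for $a\in S$. *)

(* Defs.v *)
From HB Require Import structures.
From mathcomp Require Import all_boot all_order all_algebra.
From mathcomp Require Import all_classical topology.

Set Implicit Arguments.
Unset Strict Implicit.
Unset Printing Implicit Defensive.

Import Order.TTheory GRing.Theory.
Local Open Scope ring_scope.

Section Representations.
Context (k : fieldType) {d : Order.disp_t} (T : orderType d).

(* A functor from the poset T to k-vector spaces.  Proofs of x <= y are unique
   (they are boolean equalities), so rep_map depends on x and y only. *)
Record rep : Type := Rep {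
  rep_obj :> T -> lmodType k;
  rep_map : forall x y : T, (x <= y)%O -> {linear rep_obj x -> rep_obj y};
  rep_id : forall (x : T) (v : rep_obj x), rep_map (lexx x) v = v;
  rep_comp : forall (x y z : T) (xy : (x <= y)%O) (yz : (y <= z)%O)
    (v : rep_obj x), rep_map yz (rep_map xy v) = rep_map (le_trans xy yz) v
}.

Record hom (M N : rep) : Type := Hom {
  hom_fun :> forall x : T, {linear M x -> N x};
  hom_nat : forall (x y : T) (xy : (x <= y)%O) (v : M x),
    hom_fun y (rep_map M xy v) = rep_map N xy (hom_fun x v)
}.

Definition hom_zero (M N : rep) : Prop :=
  forall (f : hom M N) (x : T) (v : M x), f x v = 0.

Definition monomorphism (M N : rep) (f : hom M N) : Prop :=
  forall (L : rep) (g h : hom L M),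
    (forall (x : T) (v : L x), f x (g x v) = f x (h x v)) ->
    forall (x : T) (v : L x), g x v = h x v.

Definition isomorphic (M N : rep) : Prop :=
  exists (f : hom M N) (g : hom N M),
    forall x : T, cancel (f x) (g x) /\ cancel (g x) (f x).

Definition zero_object (M : rep) : Prop := forall (x : T) (v : M x), v = 0.

Definition injective_object (E : rep) : Prop :=
  forall (M N : rep) (i : hom M N) (f : hom M E), monomorphism i ->
    exists g : hom N E, forall (x : T) (v : M x), g x (i x v) = f x v.

Section DirectSum.
Variables M N : rep.

Definition dsum_fun (x y : T) (xy : (x <= y)%O) (v : M x * N x) : M y * N y :=
  (rep_map M xy v.1, rep_map N xy v.2).

Fact dsum_fun_linear (x y : T) (xy : (x <= y)%O) : linear (dsum_fun xy).
Proof. by move=> a u v; rewrite /dsum_fun /= !linearP. Qed.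

HB.instance Definition _ (x y : T) (xy : (x <= y)%O) :=
  GRing.isLinear.Build k (M x * N x)%type (M y * N y)%type *:%R (dsum_fun xy)
    (dsum_fun_linear xy).

Definition dsum : rep.
Proof.
refine (@Rep (fun x : T => (M x * N x)%type : lmodType k)
  (fun x y xy => dsum_fun xy) _ _).
- by move=> x [u v]; rewrite /= /dsum_fun /= !rep_id.
- by move=> x y z xy yz [u v]; rewrite /= /dsum_fun /= !rep_comp.
Defined.

End DirectSum.

Definition zero_rep : rep :=
  @Rep (fun=> 'rV[k]_0) (fun _ _ _ => idfun) (fun _ _ => erefl)
    (fun _ _ _ _ _ _ => erefl).

Definition indecomposable (M : rep) : Prop :=
  ~ zero_object M /\
  forall A B : rep, isomorphic M (dsum A B) -> zero_object A \/ zero_object B.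

Section Representable.
Variable x : T.

(* The value of h^x at t is k^1 if x <= t and k^0 otherwise, the boolean
   (x <= t) being read as a dimension; pid_mx 1 : 'M_((x <= s), (x <= t)) is the
   identity of k when x <= s <= t, and has no entries when x <= s fails. *)
Definition h_fun (s t : T) (st : (s <= t)%O) :
    {linear 'rV[k]_(x <= s)%O -> 'rV[k]_(x <= t)%O} :=
  mulmxr (pid_mx 1).

Fact h_id (s : T) (v : 'rV[k]_(x <= s)%O) : h_fun (lexx s) v = v.
Proof.
by move: v; rewrite /h_fun; case: (x <= s)%O => v;
  rewrite /= ?pid_mx_1 ?mulmx1 // [LHS]thinmx0 [RHS]thinmx0.
Qed.

Fact h_comp (s t u : T) (st : (s <= t)%O) (tu : (t <= u)%O)
    (v : 'rV[k]_(x <= s)%O) :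
  h_fun tu (h_fun st v) = h_fun (le_trans st tu) v.
Proof.
rewrite /h_fun /= -mulmxA; congr (_ *m _); rewrite mul_pid_mx.
case xs: (x <= s)%O; last by rewrite [LHS]flatmx0 [RHS]flatmx0.
by rewrite (le_trans xs st).
Qed.

Definition hrep : rep :=
  @Rep (fun t : T => 'rV[k]_(x <= t)%O) h_fun h_id h_comp.

End Representable.

Definition dsum_h (xs : seq T) : rep := foldr dsum zero_rep (map hrep xs).

(* Exactness in the functor category is exactness at every t. *)
Definition finitely_presented (M : rep) : Prop :=
  exists (xs ys : seq T) (f : hom (dsum_h xs) (dsum_h ys))
    (g : hom (dsum_h ys) M),
    (forall (t : T) (v : dsum_h ys t), g t v = 0 <-> exists w, f t w = v) /\
    (forall (t : T) (m : M t), exists v, g t v = m).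

Definition spectrum (Sp : rep -> Prop) : Prop :=
  [/\ forall M : rep, Sp M -> indecomposable M /\ injective_object M,
      forall M : rep, indecomposable M -> injective_object M ->
        exists N : rep, Sp N /\ isomorphic M N
    & forall M N : rep, Sp M -> Sp N -> isomorphic M N -> M = N].

Section Ziegler.
Variable Sp : rep -> Prop.
Implicit Type U : {X : rep | Sp X} -> Prop.

(* Subsets of the spectrum are bare predicates: the large type rep does not fit
   in the universe of classical_sets.set, which is below that of lmodType. *)
Definition left_perp U (C : rep) : Prop :=
  finitely_presented C /\
  forall X : {X : rep | Sp X}, U X -> hom_zero C (sval X).

Definition right_perp (CC : rep -> Prop) (X : {X : rep | Sp X}) : Prop :=
  forall C : rep, CC C -> hom_zero C (sval X).

Definition ziegler_closure U : {X : rep | Sp X} -> Prop :=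
  right_perp (left_perp U).

Definition ziegler_closed U : Prop := forall X, ziegler_closure U X <-> U X.

Definition ziegler_open U : Prop := ziegler_closed (fun X => ~ U X).

End Ziegler.

Lemma isomorphic_refl (M : rep) : isomorphic M M.
Proof.
by exists (@Hom M M (fun=> idfun) (fun _ _ _ _ => erefl)),
  (@Hom M M (fun=> idfun) (fun _ _ _ _ => erefl)).
Qed.

Lemma isomorphic_sym (M N : rep) : isomorphic M N -> isomorphic N M.
Proof. by case=> f [g fg]; exists g, f => x; have [] := fg x. Qed.

Lemma hom_comp (A B C : rep) (f : hom A B) (g : hom B C) :
  exists e : hom A C, forall (x : T) (v : A x), e x v = g x (f x v).
Proof.
have nat x y (xy : (x <= y)%O) (v : A x) :
    (g y \o f y) (rep_map A xy v) = rep_map C xy ((g x \o f x) v).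
  by rewrite /= !hom_nat.
by exists (@Hom A C (fun x => g x \o f x) nat).
Qed.

Lemma isomorphic_trans (M N P : rep) :
  isomorphic M N -> isomorphic N P -> isomorphic M P.
Proof.
move=> [f [f' ff']] [g [g' gg']].
have [e eE] := hom_comp f g; have [e' e'E] := hom_comp g' f'.
exists e, e' => x; have [fK f'K] := ff' x; have [gK g'K] := gg' x.
by split=> v; rewrite ?eE ?e'E ?eE ?gK ?fK ?f'K ?g'K.
Qed.

Lemma indecomposable_iso (M N : rep) :
  isomorphic M N -> indecomposable M -> indecomposable N.
Proof.
move=> MN [M0 Mdec]; split=> [N0|A B NAB].
  apply: M0 => x v; case: MN => f [g fg]; have [fK _] := fg x.
  by rewrite -[v]fK (N0 x (f x v)) raddf0.
exact: Mdec (isomorphic_trans MN NAB).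
Qed.

Lemma injective_object_iso (M N : rep) :
  isomorphic M N -> injective_object M -> injective_object N.
Proof.
move=> [f [g fg]] Minj A B i u imono.
have [gu guE] := hom_comp u g.
have [w wE] := Minj A B i gu imono.
have [fw fwE] := hom_comp w f.
by exists fw => x v; rewrite fwE wE guE; have [_ ->] := fg x.
Qed.

Lemma spectrum_exists : exists Sp : rep -> Prop, spectrum Sp.
Proof.
have ex M : exists N, isomorphic M N by exists M; exact: isomorphic_refl.
pose c (Q : rep -> Prop) (e : exists N, Q N) := sval (cid e).
have cP Q e : Q (c Q e) by rewrite /c; case: cid.
have cE Q Q' e e' : Q = Q' -> c Q e = c Q' e'.
  by move=> QQ'; subst Q'; congr c; exact: Prop_irrelevance.
have isoE M N : isomorphic M N -> isomorphic M = isomorphic N.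
  move=> MN; apply/funext => L; apply/propext; split=> [ML|NL].
    exact: isomorphic_trans (isomorphic_sym MN) ML.
  exact: isomorphic_trans MN NL.
exists (fun N => [/\ indecomposable N, injective_object N & N = c _ (ex N)]).
split=> [M [] //|M Mdec Minj|M N [_ _ ->] [_ _ ->] MN].
  have MN := cP _ (ex M); exists (c _ (ex M)); split=> //; split.
  - exact: indecomposable_iso MN Mdec.
  - exact: injective_object_iso MN Minj.
  - exact/cE/isoE.
apply/cE/isoE; apply: isomorphic_trans (cP _ (ex M)) _.
exact: isomorphic_trans MN (isomorphic_sym (cP _ (ex N))).
Qed.

End Representations.

Section Ideals.
Local Open Scope classical_set_scope.
Context {d : Order.disp_t} (T : orderType d).

Definition is_ideal (I : set T) : Prop :=
  I !=set0 /\ forall x y : T, (x <= y)%O -> I y -> I x.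

Record Idl : Type := MkIdl {
  idl_set :> set T;
  idl_prop : is_ideal idl_set
}.

HB.instance Definition _ := gen_eqMixin Idl.
HB.instance Definition _ := gen_choiceMixin Idl.

Definition idl_le (I J : Idl) : bool := `[< I `<=` J >].

Fact idl_le_refl : reflexive idl_le.
Proof. by move=> I; apply/asboolP. Qed.

Fact idl_le_anti : antisymmetric idl_le.
Proof.
move=> [I Iid] [J Jid] /andP[/asboolP/= IJ /asboolP/= JI].
have E : I = J by apply/seteqP.
by subst J; congr MkIdl; exact: Prop_irrelevance.
Qed.

Fact idl_le_trans : transitive idl_le.
Proof.
move=> J I K /asboolP IJ /asboolP JK; apply/asboolP.
exact: subset_trans IJ JK.
Qed.

Fact idl_le_total : total idl_le.
Proof.
move=> I J; apply/orP.
have [IJ|] := pselect (I `<=` J); first by left; apply/asboolP.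
move=> /existsNP[x /not_implyP[Ix nJx]]; right; apply/asboolP => y Jy.
have [_ Idown] := idl_prop I; have [_ Jdown] := idl_prop J.
have [xy|/ltW yx] := leP x y; last exact: Idown yx Ix.
by case: nJx; exact: Jdown xy Jy.
Qed.

Fact idl_display : Order.disp_t. Proof. exact: Order.Disp tt tt. Qed.

HB.instance Definition _ := Order.Le_isPOrder.Build idl_display Idl
  idl_le_refl idl_le_anti idl_le_trans.
HB.instance Definition _ :=
  Order.POrder_isTotal.Build idl_display Idl idl_le_total.

Definition idl_open (V : set Idl) : Prop := @open (order_topology Idl) V.

End Ideals.

(* A bijection under which the open sets correspond; openX and openY are the
   collections of open sets of X and Y. *)
Definition homeomorphism (X Y : Type) (openX : (X -> Prop) -> Prop)
    (openY : (Y -> Prop) -> Prop) (f : X -> Y) : Prop :=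
  [/\ bijective f,
      forall V : Y -> Prop, openY V -> openX (fun x => V (f x))
    & forall U : X -> Prop, openX U -> openY (fun y => exists2 x, U x & f x = y)].

(* Main.v *)
Require Import Defs.
From HB Require Import structures.
From mathcomp Require Import all_boot all_order all_algebra.
From mathcomp Require Import all_classical topology.
(* Otherwise [hom] would denote the linear maps of MathComp's vector.v *)
Import Defs.

(* For an ideal I of T let k_I be the representation with value k on I and 0
   elsewhere.  Hom(-, k_I) is the dual of the exact functor colim_I, so k_I is
   injective, and it is indecomposable because its nonzero elements are
   proportional after restriction.  Conversely, a nonzero element v of degree x
   of an injective E generates a submodule k_J with J an interval starting at x;
   the inclusion k_J -> E extends to the down-closure I of J, the extension is
   again a monomorphism, and it splits.  So the spectrum is in bijection with
   the ideals.
   For the topologies, the sets {J | x in J, y_1, ..., y_n not in J} form a base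
   of the order topology.  They are the sets {J | Hom(C, k_J) <> 0} for C the
   quotient of h^x by the images of the h^{y_i}; and for an arbitrary finitely
   presented C the set {J | Hom(C, k_J) <> 0} is open, since a morphism from a
   finite sum of h^y to k_I lifts to the constant representation k_T, hence
   makes sense for every J, and whether it kills the finitely many relations
   only depends on the degrees of these relations that lie in J. *)

Set Implicit Arguments.
Unset Strict Implicit.
Unset Printing Implicit Defensive.

Import Order.TTheory GRing.Theory.
Local Open Scope ring_scope.

(** * Interval representations, the Yoneda lemma and monomorphisms *)

Section IntervalRepresentations.
Context (k : fieldType) {d : Order.disp_t} (T : orderType d).
Implicit Types (M N : rep k T) (S : pred T) (x y z s t : T).

(** The space is $k^1$ or $k^0$: the sum of the entries is the coordinate in the first case and 0 in
    the second, which treats both uniformly. *)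
Definition coef (b : bool) (v : 'rV[k]_b) : k := \sum_j v 0 j.

Lemma coefK (b : bool) (v : 'rV[k]_b) : const_mx (coef v) = v.
Proof.
case: b v => v; last by rewrite [LHS]thinmx0 [RHS]thinmx0.
by apply/rowP => j; rewrite mxE /coef (big_ord1 _ (fun j => v 0 j)) (ord1 j).
Qed.

Lemma coef_const (b : bool) (c : k) : coef (const_mx c : 'rV_b) = c *+ b.
Proof.
by rewrite /coef (eq_bigr (fun=> c)) ?sumr_const ?card_ord // => j; rewrite mxE.
Qed.

Lemma coef_is_linear (b : bool) : linear (@coef b : _ -> k^o).
Proof.
move=> a u v; rewrite /coef scaler_sumr -big_split /=.
by apply: eq_bigr => j _; rewrite !mxE.
Qed.

HB.instance Definition _ (b : bool) :=
  GRing.isLinear.Build k 'rV[k]_b k^o *:%R (@coef b) (@coef_is_linear b).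

Lemma coef_eq0 (b : bool) (v : 'rV[k]_b) : (coef v == 0) = (v == 0).
Proof.
apply/eqP/eqP => [v0|->]; last exact: raddf0.
by rewrite -(coefK v) v0; apply/rowP => j; rewrite !mxE.
Qed.

Lemma const_row0 n : const_mx 0 = 0 :> 'rV[k]_n.
Proof. by apply/rowP => j; rewrite !mxE. Qed.

Lemma row_boolP (b : bool) : b \/ forall v : 'rV[k]_b, v = 0.
Proof. by case: b; [left|right=> v; rewrite thinmx0]. Qed.

Lemma coef_mul_const1 (a b : bool) (v : 'rV[k]_a) :
  v *m const_mx 1 = const_mx (coef v) :> 'rV_b.
Proof.
by apply/rowP => j; rewrite !mxE; apply: eq_bigr => i _; rewrite mxE mulr1.
Qed.

Lemma hrep_mapE x s t (st : (s <= t)%O) (v : hrep k x s) :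
  rep_map (hrep k x) st v = const_mx (coef v).
Proof.
rewrite -coef_mul_const1 /= /h_fun /=; congr (_ *m _); apply/matrixP => i j.
rewrite !mxE; case: (x <= s)%O i => [|[]//]; case: (x <= t)%O j => [|[]//] j i.
by rewrite !ord1.
Qed.

Definition convex_pred S :=
  forall x y z, (x <= y)%O -> (y <= z)%O -> S x -> S z -> S y.

Section IntervalRep.
Variables (S : pred T) (cS : convex_pred S).

Definition irep_fun s t (st : (s <= t)%O) :
    {linear 'rV[k]_(S s) -> 'rV[k]_(S t)} :=
  mulmxr (const_mx 1).

Fact irep_id s (v : 'rV[k]_(S s)) : irep_fun (lexx s) v = v.
Proof. by rewrite /irep_fun /= coef_mul_const1 coefK. Qed.

(** Convexity excludes a passage through 0: if [s] and [u] are in [S], so is [t]. *)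
Fact irep_comp s t u (st : (s <= t)%O) (tu : (t <= u)%O) (v : 'rV[k]_(S s)) :
  irep_fun tu (irep_fun st v) = irep_fun (le_trans st tu) v.
Proof.
rewrite /irep_fun /= !coef_mul_const1 coef_const.
have [Su|z] := row_boolP (S u); last by rewrite [LHS]z [RHS]z.
have [Ss|z] := row_boolP (S s).
  by rewrite (cS st tu).
by rewrite (z v) raddf0 mul0rn.
Qed.

Definition irep : rep k T :=
  @Rep k d T (fun t => 'rV[k]_(S t)) irep_fun irep_id irep_comp.

Lemma irep_mapE s t (st : (s <= t)%O) (v : irep s) :
  rep_map irep st v = const_mx (coef v).
Proof. exact: coef_mul_const1. Qed.

End IntervalRep.

Lemma build_hom M N (F : forall x, M x -> N x) :
  (forall x, linear (F x)) ->
  (forall x y (xy : (x <= y)%O) v,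
    F y (rep_map M xy v) = rep_map N xy (F x v)) ->
  exists f : hom M N, forall x v, f x v = F x v.
Proof.
move=> Flin Fnat.
pose G x : {linear M x -> N x} :=
  HB.pack (F x) (GRing.isLinear.Build k (M x) (N x) *:%R (F x) (Flin x)).
by exists (@Hom k d T M N G Fnat).
Qed.

(** Naturality matters only at [y] in [S], the target being 0 elsewhere; for [x] outside [S] it says
    that [l y] kills what comes from [x]. *)
Lemma hom_to_irep M S (cS : convex_pred S) (l : forall x, M x -> k) :
  (forall x, S x -> linear (l x : M x -> k^o)) ->
  (forall x y (xy : (x <= y)%O) v, S y ->
     l y (rep_map M xy v) = l x v *+ S x) ->
  exists f : hom M (irep cS), forall x v, f x v = const_mx (l x v).
Proof.
move=> llin lnat; apply: build_hom => [x a u v|x y xy v].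
  have [Sx|z] := row_boolP (S x); last by rewrite [LHS]z [RHS]z.
  by rewrite llin //; apply/rowP => j; rewrite !mxE.
have [Sy|z] := row_boolP (S y); last by rewrite [LHS]z [RHS]z.
by rewrite irep_mapE coef_const lnat.
Qed.

Lemma hom_from_irep M S (cS : convex_pred S) (u : forall t, M t) :
  (forall s t (st : (s <= t)%O), S s -> rep_map M st (u s) = u t *+ S t) ->
  exists f : hom (irep cS) M, forall t v, f t v = coef v *: u t.
Proof.
move=> unat; apply: build_hom => [x a v w|s t st v].
  by rewrite linearP /= scalerDl scalerA.
rewrite irep_mapE coef_const linearZ /=.
have [Ss|z] := row_boolP (S s).
  by rewrite unat // -scalerMnl scalerMnr.
by rewrite (z v) raddf0 mul0rn !scale0r.
Qed.

(* The structure map extended by 0, to avoid carrying proofs of [x <= t]. *)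
Definition tmap M x t : M x -> M t :=
  if @idP (x <= t)%O is ReflectT xt then rep_map M xt else fun=> 0.

Lemma tmapE M x t (xt : (x <= t)%O) v : tmap t v = rep_map M xt v.
Proof.
by rewrite /tmap; case: {-}_ / idP => // xt'; rewrite (bool_irrelevance xt xt').
Qed.

Lemma rep_map_tmap M x s t (xs : (x <= s)%O) (st : (s <= t)%O) (v : M x) :
  rep_map M st (tmap s v) = tmap t v.
Proof. by rewrite (tmapE xs) rep_comp (tmapE (le_trans xs st)). Qed.

Lemma tmap_comp M x s t (v : M x) :
  (x <= s)%O -> (s <= t)%O -> tmap t (tmap s v) = tmap t v.
Proof. by move=> xs st; rewrite (tmapE st) rep_map_tmap. Qed.

Lemma tmapxx M x (v : M x) : tmap x v = v.
Proof. by rewrite (tmapE (lexx x)) rep_id. Qed.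

Lemma tmap_linear M x t : linear (@tmap M x t).
Proof.
move=> a u v; rewrite /tmap; case: {-}_ / idP => xt; first exact: linearP.
by rewrite scaler0 addr0.
Qed.

HB.instance Definition _ M x t :=
  GRing.isLinear.Build k (M x) (M t) *:%R (@tmap M x t) (@tmap_linear M x t).

Lemma hom_tmap M N (f : hom M N) x t (v : M x) : f t (tmap t v) = tmap t (f x v).
Proof.
rewrite /tmap; case: {-}_ / idP => xt; first exact: hom_nat.
exact: raddf0.
Qed.

(** Existence in the Yoneda lemma; [hrep_homE] is the uniqueness. *)
Lemma hom_from_hrep M x (u : M x) :
  exists f : hom (hrep k x) M, forall t v, f t v = coef v *: tmap t u.
Proof.
apply: build_hom => [t a v w|s t st v].
  by rewrite linearP /= scalerDl scalerA.
rewrite hrep_mapE linearZ /= coef_const.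
have [xs|z] := row_boolP (x <= s)%O.
  by rewrite rep_map_tmap // (le_trans xs st).
by rewrite (z v) raddf0 mul0rn !scale0r.
Qed.

Lemma hrep_homE M x (f : hom (hrep k x) M) t v :
  f t v = coef v *: tmap t (f x (const_mx 1)).
Proof.
have [xt|z] := row_boolP (x <= t)%O; last first.
  by rewrite (z v) !raddf0 scale0r.
rewrite -hom_tmap (tmapE xt) hrep_mapE coef_const lexx -linearZ /=; congr (f t _).
by rewrite -[LHS]coefK; apply/rowP => j; rewrite !mxE mulr1.
Qed.

Lemma zero_hom M N : exists f : hom M N, forall x v, f x v = 0.
Proof.
by apply: build_hom => [x a u v|x y xy v]; rewrite ?scaler0 ?addr0 ?raddf0.
Qed.

(** By Yoneda, an element killed by [f] is a morphism from [hrep k x] that [f] does not distinguish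
    from zero. *)
Lemma monomorphism_inj M N (f : hom M N) :
  monomorphism f <-> forall x (v : M x), f x v = 0 -> v = 0.
Proof.
split=> [fm x v fv0|finj L g h fgh x v]; last first.
  by apply/eqP; rewrite -subr_eq0; apply/eqP/finj; rewrite linearB /= fgh subrr.
have [g gE] := hom_from_hrep v.
have [z zE] := zero_hom (hrep k x) M.
have /(_ x (const_mx 1)) : forall t w, g t w = z t w.
  by apply: fm => t w; rewrite gE zE linearZ /= hom_tmap fv0 !raddf0.
by rewrite gE zE tmapxx coef_const lexx scale1r.
Qed.

End IntervalRepresentations.

(** * Injectivity of the representations of ideals, by extension of functionals *)

Definition down_closed {d : Order.disp_t} {T : orderType d} (I : pred T) :=
  forall x y : T, (x <= y)%O -> I y -> I x.

Lemma down_closed_convex {d : Order.disp_t} {T : orderType d} (I : pred T) :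
  down_closed I -> convex_pred I.
Proof. by move=> dI x y z _ yz _; exact: dI. Qed.

Section Injectivity.
Context (k : fieldType) {d : Order.disp_t} (T : orderType d).
Variables (I : pred T) (dI : down_closed I).
Let E : rep k T := irep k (down_closed_convex dI).
Variables (M N : rep k T) (i : hom M N) (f : hom M E).
Hypothesis i_inj : forall x (v : M x), i x v = 0 -> v = 0.
Implicit Types x y z : T.

Let phi x (u : M x) : k := coef (f x u).

Let phi_tmap x y (u : M x) : (x <= y)%O -> I y -> phi (tmap y u) = phi u.
Proof.
move=> xy Iy; rewrite /phi (tmapE xy) hom_nat irep_mapE coef_const.
by rewrite Iy.
Qed.

Let phi_linear x : linear (@phi x : M x -> k^o).
Proof. by move=> a u v; rewrite /phi linearP; exact: coef_is_linear. Qed.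

(* [good G] says that [G] is the graph of a linear functional on a subspace of
   the colimit of [N] over [I], compatible with the functional [phi] on the
   colimit of [M]. *)
Let graph := classical_sets.set ({x : T & N x} * k)%type.
Let gr (G : graph) x (v : N x) (c : k) : Prop := G (existT _ x v, c).

Let good (G : graph) : Prop :=
  [/\ forall x (v : N x) c, gr G v c -> I x,
      forall x (v w : N x) c e a, gr G v c -> gr G w e ->
        gr G (a *: v + w) (a * c + e),
      forall x y (v : N x) c, (x <= y)%O -> I y -> gr G v c <-> gr G (tmap y v) c
    & forall x (u : M x) c, gr G (i x u) c -> c = phi u].

(** Zorn's lemma: the union of a chain of good graphs is good. The empty chain gives the empty
    graph, which is good too. *)
Let exists_maximal :
  exists G, good G /\ forall B, good B -> subset G B -> subset B G.
Proof.
have [F Fgood Ftot|G [Ggood Gmax]] := @Zorn_bigcup _ good; last first.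
  exists G; split=> // B gB GB; apply: contrapT => nBG.
  exact: (Gmax B (conj GB nBG)).
split=> [x v c [A FA Av]|x v w c e a [A FA Av] [B FB Bw]|x y v c xy Iy
  |x u c [A FA Au]].
- have [AI _ _ _] := Fgood A FA; exact: AI Av.
- have [_ Alin _ _] := Fgood A FA; have [_ Blin _ _] := Fgood B FB.
  case: (Ftot _ _ FA FB) => AB; [exists B|exists A] => //.
    by apply: Blin => //; exact: AB.
  by apply: Alin => //; exact: AB.
- split=> -[A FA Av]; exists A => //; have [_ _ Atr _] := Fgood A FA.
    exact/(Atr _ _ v c xy Iy).
  exact/(Atr _ _ v c xy Iy).
- by have [_ _ _] := Fgood A FA; apply.
Qed.

Let upper_bound y z : I y -> I z -> exists m, [/\ (y <= m)%O, (z <= m)%O & I m].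
Proof. by move=> Iy Iz; case: (leP y z) => [yz|/ltW zy]; [exists z|exists y]. Qed.

Section Maximal.
Variable (G : graph).
Hypotheses (gG : good G) (maxG : forall B, good B -> subset G B -> subset B G).

Let GI x (v : N x) c : gr G v c -> I x.
Proof. by case: gG => + _ _ _; apply. Qed.
Let Glin x (v w : N x) c e a :
  gr G v c -> gr G w e -> gr G (a *: v + w) (a * c + e).
Proof. by case: gG => _ + _ _; apply. Qed.
Let Gtr x y (v : N x) c : (x <= y)%O -> I y -> gr G v c <-> gr G (tmap y v) c.
Proof. by case: gG => _ _ + _; apply. Qed.
Let Gphi x (u : M x) c : gr G (i x u) c -> c = phi u.
Proof. by case: gG => _ _ _; apply. Qed.

(** A nonempty [G] contains some element minus itself, and this zero moves to degree [x] through a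
    common upper bound. *)
Let G0 x : I x -> gr G (0 : N x) 0.
Proof.
move=> Ix; have [|noG] := pselect (exists p, G p).
  case=> -[[y v] c] Gp; have Iy := GI Gp; have : gr G (0 : N y) 0.
    by have := Glin (-1) Gp Gp; rewrite scaleN1r addNr mulN1r addNr.
  have [m [xm ym Im]] := upper_bound Ix Iy.
  by rewrite (Gtr _ _ ym Im) (Gtr _ _ xm Im) !raddf0.
(* For empty [G]: the zero functional on the elements that vanish in the colimit over [I]. It agrees
   with [phi] because [i] is injective. *)
pose Z : graph := fun p => [/\ I (tag p.1), p.2 = 0 &
  exists y, [/\ (tag p.1 <= y)%O, I y & tmap y (tagged p.1) = 0]].
suff gZ : good Z.
  apply: (maxG gZ) => [p Gp|]; first by case: noG; exists p.
  by split=> //; exists x; rewrite raddf0.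
split=> /=.
- by move=> {Ix}x v c [].
- move=> {Ix}x v w c e a [/= Ix -> [y [xy Iy vy]]] [/= _ -> [z [xz Iz wz]]].
  split=> //=; first by rewrite mulr0 addr0.
  have [m [ym zm Im]] := upper_bound Iy Iz.
  exists m; split; rewrite ?(le_trans xy) //.
  rewrite linearP /= -(tmap_comp _ xy ym) vy -(tmap_comp _ xz zm) wz.
  by rewrite !raddf0 addr0.
- move=> {Ix}x y v c xy Iy; split=> -[/= Ix -> [z [xz Iz vz]]]; split=> //=.
  + have [m [ym zm Im]] := upper_bound Iy Iz.
    by exists m; split=> //; rewrite tmap_comp // -(tmap_comp _ xz zm) vz raddf0.
  + exact: dI Iy.
  + by exists z; rewrite -(tmap_comp _ xy xz) (le_trans xy).
- move=> {Ix}x u c [/= Ix -> [y [xy Iy]]]; rewrite -hom_tmap => /i_inj u0.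
  by rewrite -(phi_tmap u xy Iy) u0 /phi !raddf0.
Qed.

(** A suitable value at [v0] extends [G] to a good graph, which lies in [G] by maximality. *)
Let Gtotal x0 (v0 : N x0) : I x0 -> exists c, gr G v0 c.
Proof.
move=> Ix0.
(* The value at [v0] is forced as soon as some image of [v0] lies in the
   domain of [G] up to an element of [M]. *)
pose forced c := exists y u e, [/\ (x0 <= y)%O, I y,
  gr G (tmap y v0 - i y u) e & c = e + phi u].
(* Two forced values agree: the two elements of the domain of [G] differ by an element from [M],
   where [G] is [phi]. If nothing is forced, the arbitrary value 0 is taken. *)
have [cs csE] : exists cs, forall c, forced c -> c = cs.
  have [[cs [y [u [e [x0y Iy Ge _]]]]]|nof] := pselect (exists c, forced c).
    exists (e + phi u) => _ [z [w [e' [x0z Iz Ge' ->]]]].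
    have [m [ym zm Im]] := upper_bound Iy Iz.
    move: Ge Ge'; rewrite (Gtr _ _ ym Im) (Gtr _ _ zm Im) => Ge Ge'.
    have := Glin (-1) Ge Ge'.
    rewrite !(raddfB (tmap m)) /= !tmap_comp // scaleN1r opprB addrA subrK.
    rewrite -!hom_tmap -raddfB; move=> /Gphi.
    rewrite /phi !raddfB /= -!/(phi _) !phi_tmap // mulN1r => /eqP.
    by rewrite addrC subr_eq addrAC -subr_eq opprK addrC => /eqP ->.
  by exists 0 => c fc; case: nof; exists c.
(* The span of [G] and of [v0] with value [cs]; the decomposition need only hold after passing to a
   larger degree [y] in [I]. *)
pose B : graph := fun p => I (tag p.1) /\ exists y,
  [/\ (tag p.1 <= y)%O, (x0 <= y)%O, I y & exists (a : k) (w : N y) c,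
  [/\ tmap y (tagged p.1) = a *: tmap y v0 + w, p.2 = a * cs + c & gr G w c]].
have raise x y z (v : N x) (a c : k) (w : N y) : (x <= y)%O -> (x0 <= y)%O ->
    (y <= z)%O -> I z ->
    tmap y v = a *: tmap y v0 + w -> gr G w c ->
    tmap z v = a *: tmap z v0 + tmap z w /\ gr G (tmap z w) c.
  move=> xy x0y yz Iz vE Gw; split; last exact/(Gtr _ _ yz Iz).
  by rewrite -(tmap_comp _ xy yz) vE linearP /= tmap_comp.
suff gB : good B.
  exists cs; apply: (maxG gB) => [[[x v] c] Gv|]; last first.
    split=> //; exists x0; split=> //; exists 1, 0, 0.
    by rewrite scale1r addr0 mul1r addr0; split=> //; exact: G0.
  have Ix := GI Gv; split=> //.
  have [m [xm x0m Im]] := upper_bound Ix Ix0.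
  exists m; split=> //; exists 0, (tmap m v), c.
  by rewrite scale0r mul0r !add0r; split=> //; exact/(Gtr _ _ xm Im).
split=> /=.
- by move=> x v c [].
- move=> x v w c e b.
  move=> [/= Ix [y [xy x0y Iy [a1 [v1 [c1 [vE -> Gv1]]]]]]].
  move=> [/= _ [z [xz x0z Iz [a2 [w2 [c2 [wE -> Gw2]]]]]]].
  split=> //=; have [m [ym zm Im]] := upper_bound Iy Iz.
  exists m; rewrite (le_trans xy) // (le_trans x0y) //; split=> //.
  have [{}vE {}Gv1] := raise _ _ _ _ _ _ _ xy x0y ym Im vE Gv1.
  have [{}wE {}Gw2] := raise _ _ _ _ _ _ _ xz x0z zm Im wE Gw2.
  exists (b * a1 + a2), (b *: tmap m v1 + tmap m w2), (b * c1 + c2); split.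
  + by rewrite linearP /= vE wE scalerDr addrACA scalerDl scalerA.
  + by rewrite mulrDl mulrDr addrACA mulrA.
  + exact: Glin.
- move=> x y v c xy Iy; split=> -[/= Ix [z [xz x0z Iz [a [w [e [vE -> Gw]]]]]]].
  + split=> //=; have [m [ym zm Im]] := upper_bound Iy Iz.
    have [{}vE {}Gw] := raise _ _ _ _ _ _ _ xz x0z zm Im vE Gw.
    exists m; rewrite (le_trans x0z) //; split=> //.
    by exists a, (tmap m w), e; rewrite tmap_comp.
  + split=> /=; first exact: dI Iy.
    exists z; rewrite (le_trans xy) //; split=> //.
    by exists a, w, e; rewrite -vE tmap_comp.
- move=> x u c [/= Ix [y [xy x0y Iy [a [w [e [vE -> Gw]]]]]]].
  rewrite -(phi_tmap u xy Iy); move: vE; rewrite -hom_tmap.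
  move: (tmap y u) => {}u vE.
  (* For [a = 0] the image of [u] is already in the domain of [G]; otherwise division by [a]
     exhibits a forced value at [v0], which must be [cs]. *)
  have [a0|a0] := eqVneq a 0.
    move: vE; rewrite a0 mul0r scale0r !add0r => vE.
    by apply: Gphi; rewrite vE.
  suff /csE <- : forced (a^-1 * (phi u - e)).
    by rewrite mulrA divff // mul1r subrK.
  exists y, (a^-1 *: u), (- a^-1 * e); split=> //; last first.
    have := phi_linear a^-1 u 0; rewrite addr0 => ->.
    by rewrite /phi !raddf0 addr0 mulrBr addrC mulNr.
  have <- : - a^-1 *: w + 0 = tmap y v0 - i y (a^-1 *: u).
    rewrite linearZ /= vE scalerDr scalerA mulVf // scale1r opprD addrA subrr.
    by rewrite sub0r addr0 scaleNr.
  by rewrite -[- a^-1 * e]addr0; apply: Glin => //; exact: G0.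
Qed.

Let functional x (v : N x) c e : gr G v c -> gr G v e -> c = e.
Proof.
move=> Gc Ge; have := Glin (-1) Gc Ge.
rewrite scaleN1r addNr mulN1r -(raddf0 (i x)) => /Gphi.
by rewrite /phi !raddf0 => /eqP; rewrite addrC subr_eq0 => /eqP.
Qed.

(** By [Gtotal] and [functional], [G] is a function in the degrees of [I]; in the other degrees
    [xget] returns its default 0. *)
Lemma maximal_extension :
  exists g : hom N E, forall x (v : M x), g x (i x v) = f x v.
Proof.
pose l x (v : N x) : k := xget 0 (gr G v).
have lP x (v : N x) : I x -> gr G v (l x v).
  by move=> Ix; case: (Gtotal v Ix) => c Gc; exact: (xgetI _ Gc).
have lE x (v : N x) c : gr G v c -> l x v = c.
  by move=> Gc; exact: functional (lP _ _ (GI Gc)) Gc.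
have Gbase x (u : M x) : I x -> gr G (i x u) (phi u).
  by move=> Ix; have Gl := lP x (i x u) Ix; rewrite -(Gphi Gl).
have [x Ix a v w|x y xy v Iy|g gE] :=
  @hom_to_irep k d T N I (down_closed_convex dI) l.
- by apply: lE; apply: Glin; exact: lP.
- have Ix := dI xy Iy; rewrite Ix -(tmapE xy); apply: lE.
  by rewrite -Gtr //; exact: lP.
exists g => x u; rewrite gE.
have [Ix|z] := row_boolP k (I x); last by rewrite [LHS]z [RHS]z.
by rewrite (lE _ _ _ (Gbase x u Ix)) coefK.
Qed.
End Maximal.

Lemma extend_along_mono :
  exists g : hom N E, forall x (v : M x), g x (i x v) = f x v.
Proof.
by have [G [gG maxG]] := exists_maximal; exact: maximal_extension gG maxG.
Qed.

End Injectivity.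

Lemma irep_injective (k : fieldType) (d : Order.disp_t) (T : orderType d)
    (I : pred T) (dI : down_closed I) :
  injective_object (irep k (down_closed_convex dI)).
Proof. by move=> M N i f /monomorphism_inj /extend_along_mono. Qed.

(** * Kernels as representations, used to split off summands *)

Section LinearKernel.
Context (k : fieldType) (U V : lmodType k) (f : {linear U -> V}).

Definition ker_pred : {pred U} := [pred v | f v == 0].

Fact ker_submod_closed : submod_closed ker_pred.
Proof.
split=> [|a u v]; rewrite !inE ?raddf0 // => /eqP u0 /eqP v0.
by rewrite linearP u0 v0 scaler0 addr0.
Qed.

HB.instance Definition _ :=
  GRing.isSubmodClosed.Build k U ker_pred ker_submod_closed.

Definition kernel := {v : U | v \in ker_pred}.
HB.instance Definition _ := SubChoice.on kernel.
HB.instance Definition _ := [SubChoice_isSubLmodule of kernel by <:].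

End LinearKernel.

Section KernelRepresentation.
Context (k : fieldType) {d : Order.disp_t} (T : orderType d).
Variables (M N : rep k T) (f : hom M N).

Fact ker_map_subproof (s t : T) (st : (s <= t)%O) (v : kernel (f s)) :
  rep_map M st (val v) \in ker_pred (f t).
Proof. by rewrite inE hom_nat; case: v => v /= /eqP ->; rewrite raddf0. Qed.

Definition ker_map (s t : T) (st : (s <= t)%O) (v : kernel (f s)) : kernel (f t) :=
  Sub (rep_map M st (val v)) (ker_map_subproof st v).

Fact ker_map_linear (s t : T) (st : (s <= t)%O) : linear (ker_map st).
Proof. by move=> a u v; apply: val_inj; rewrite /= !linearP. Qed.

HB.instance Definition _ (s t : T) (st : (s <= t)%O) :=
  GRing.isLinear.Build k (kernel (f s)) (kernel (f t)) *:%R (ker_map st)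
    (ker_map_linear st).

Definition ker_rep : rep k T.
Proof.
refine (@Rep k d T (fun t : T => kernel (f t) : lmodType k)
  (fun s t st => @ker_map s t st) _ _).
- by move=> x v; apply: val_inj; rewrite /= rep_id.
- by move=> x y z xy yz v; apply: val_inj; rewrite /= rep_comp.
Defined.

End KernelRepresentation.

(** * Indecomposable injectives are the representations of ideals *)

Section Classification.
Context (k : fieldType) {d : Order.disp_t} (T : orderType d).
Implicit Types (M N E : rep k T) (I : pred T).

Local Notation ideal_rep dI := (irep k (down_closed_convex dI)).

(** Injectivity of [A] gives a retraction [r] of [j], so [E] is the sum of [A] and the kernel of
    [r]; as [A] is nonzero, the kernel vanishes. *)
Lemma indecomposable_split A E (j : hom A E) :
  injective_object A -> monomorphism j -> ~ zero_object A ->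
  indecomposable E -> isomorphic E A.
Proof.
move=> Ainj jmono A0 [_ Edec].
have [r rj] : exists r : hom E A, forall x (v : A x), r x (j x v) = v.
  have [h hE] : exists h : hom A A, forall x (v : A x), h x v = v.
    exact: build_hom.
  by have [r rE] := Ainj _ _ _ h jmono; exists r => x v; rewrite rE.
have ker_subproof x v : v - j x (r x v) \in ker_pred (r x).
  by rewrite inE raddfB /= rj subrr.
pose q x v : kernel (r x) := Sub (v - j x (r x v)) (ker_subproof x v).
have [f fE] : exists f : hom E (dsum A (ker_rep r)),
    forall x v, f x v = (r x v, q x v).
  apply: build_hom => [x a u v|x y xy v].
    congr pair; first by rewrite linearP.
    apply: val_inj; rewrite /= (linearP (r x)) (linearP (j x)).
    by rewrite scalerBr opprD addrACA.
  rewrite /= /dsum_fun /=; congr pair; first exact: hom_nat.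
  by apply: val_inj; rewrite /= raddfB /= !hom_nat.
have [g gE] : exists g : hom (dsum A (ker_rep r)) E,
    forall x v, g x v = j x v.1 + val v.2.
  apply: build_hom => [x a [u u'] [v v']|x y xy [v v']] /=.
    by rewrite linearP scalerDr addrACA.
  by rewrite hom_nat raddfD.
have fg : isomorphic E (dsum A (ker_rep r)).
  exists f, g => x; split=> [v|[u [w w0]]]; rewrite fE gE /=.
    by rewrite addrC subrK.
  have /eqP rw0 : r x w == 0 := w0.
  rewrite raddfD /= rj rw0 addr0; congr pair.
  by apply: val_inj; rewrite /= raddfD /= rj rw0 addr0 addrC addKr.
case: (Edec _ _ fg) => [/A0//|ker0].
exists r, j => x; split=> v; last exact: rj.
by have /(congr1 val)/= /eqP := ker0 x (q x v); rewrite subr_eq0 => /eqP <-.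
Qed.

Section IdealRepresentation.
Variables (I : pred T) (dI : down_closed I).

Lemma ideal_rep_nonzero : ~ zero_object (ideal_rep dI) <-> exists x, I x.
Proof.
split=> [nz|[x Ix] z].
  apply: contrapT => nI; apply: nz => x v.
  by have [Ix|//] := row_boolP k (I x); case: nI; exists x.
have /(congr1 (@coef k (I x))) := z x (const_mx 1).
by rewrite coef_const raddf0 Ix => /eqP; rewrite oner_eq0.
Qed.

(** Nonzero elements are proportional after restriction, whereas nonzero [(a, 0)] and [(0, b)] in a
    direct sum are not. *)
Lemma ideal_rep_indecomposable :
  (exists x, I x) -> indecomposable (ideal_rep dI).
Proof.
move=> I0; split=> [|A B [f [g fg]]]; first exact/ideal_rep_nonzero.
have nonzero x (w : dsum A B x) : w != 0 -> I x /\ coef (g x w) != 0.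
  move=> w0; have [Ix|z] := row_boolP k (I x); last first.
    by case/eqP: w0; have [_ gK] := fg x; rewrite -[w]gK (z (g x w)) raddf0.
  split=> //; apply: contraNneq w0 => /eqP; rewrite coef_eq0 => /eqP gw0.
  by have [_ gK] := fg x; rewrite -[w]gK gw0 raddf0.
have proportional x y (xy : (x <= y)%O) (v : dsum A B x) (w : dsum A B y) :
    v != 0 -> w != 0 -> exists2 c, c != 0 & w = c *: rep_map (dsum A B) xy v.
  move=> /nonzero[Ix gv0] /nonzero[Iy gw0].
  exists (coef (g y w) / coef (g x v)).
    by rewrite mulf_neq0 // invr_eq0.
  have [_ gK] := fg y; apply: (can_inj gK); rewrite linearZ /= hom_nat irep_mapE.
  rewrite -[LHS]coefK.
  by apply/rowP => i; rewrite !mxE divfK.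
apply: contrapT => /not_orP.
move=> -[/existsNP[x /existsNP[a a0]] /existsNP[y /existsNP[b b0]]].
have {}a0 : (a, 0) != 0 :> dsum A B x.
  by apply/eqP => -[].
have {}b0 : (0, b) != 0 :> dsum A B y.
  by apply/eqP => -[].
have [xy|/ltW yx] := leP x y.
  have [c c0 [_ bE]] := proportional _ _ xy _ _ a0 b0.
  by case/eqP: b0; rewrite bE /= raddf0 scaler0.
have [c c0 [aE _]] := proportional _ _ yx _ _ b0 a0.
by case/eqP: a0; rewrite aE /= raddf0 scaler0.
Qed.

End IdealRepresentation.

(** At a degree in [I] but not in [J] the identity of $k$ would factor through 0. *)
Lemma ideal_rep_iso_sub I J (dI : down_closed I) (dJ : down_closed J) :
  isomorphic (ideal_rep dI) (ideal_rep dJ) -> {subset I <= J}.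
Proof.
move=> [f [g fg]] x Ix; have [//|z] := row_boolP k (J x).
have [fK _] := fg x; have := congr1 (@coef k (I x)) (fK (const_mx 1)).
rewrite (z (f x _)) !raddf0 coef_const -[I x]/(x \in I) Ix => /eqP.
by rewrite eq_sym oner_eq0.
Qed.

(* The submodule generated by [v : E x] is the interval representation of
   [{t | x <= t & v does not vanish at t}], whose injective hull is the
   representation of the ideal it generates. *)
Lemma ideal_rep_embedding E : injective_object E -> ~ zero_object E ->
  exists (I : pred T) (dI : down_closed I) (e : hom (ideal_rep dI) E),
    (exists x, I x) /\ monomorphism e.
Proof.
move=> Einj /existsNP[x /existsNP[v /eqP v0]].
(* The down-closure of the set [J] of degrees where [v] survives; [tmap t v] is 0 unless
   [x <= t]. *)
pose I t := (t <= x)%O || (tmap t v != 0).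
have dI : down_closed I.
  move=> s t st /orP[tx|vt]; apply/orP; first by left; exact: le_trans tx.
  have [|/ltW xs] := leP s x; [by left|right].
  by apply: contraNneq vt => vs; rewrite -(rep_map_tmap xs st) vs raddf0.
pose J t := (x <= t)%O && I t.
have cJ : convex_pred J.
  move=> s t u st tu /andP[xs _] /andP[_ Iu].
  by rewrite /J (le_trans xs) // (dI _ _ tu).
have JE t : (x <= t)%O -> J t = (tmap t v != 0).
  move=> xt; rewrite /J /I xt /= orb_idl // => tx.
  have <- : x = t by apply/le_anti/andP.
  by rewrite tmapxx.
have [u uE] : exists u : hom (irep k cJ) E, forall t w, u t w = coef w *: tmap t v.
  apply: hom_from_irep => s t st /andP[xs _]; rewrite rep_map_tmap //.
  by rewrite JE ?(le_trans xs) //; case: eqVneq => [->|].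
have [i iE] : exists i : hom (irep k cJ) (ideal_rep dI),
    forall t w, i t w = const_mx (coef w).
  apply: hom_to_irep => [s _|s t st w It]; first exact: coef_is_linear.
  rewrite irep_mapE coef_const; have [/andP[xs Is]|z] := row_boolP k (J s).
    by move: (coef w) => c; rewrite Is /J It (le_trans xs st).
  by rewrite (z w) raddf0 !mul0rn.
have imono : monomorphism i.
  apply/monomorphism_inj => t w; rewrite iE => /(congr1 (@coef k (I t))).
  rewrite coef_const raddf0 => /eqP.
  have [/andP[_ ->]|z _] := row_boolP k (J t); last exact: z.
  by rewrite coef_eq0 => /eqP.
have [e eE] := Einj _ _ i u imono.
exists I, dI, e; split; first by exists x; rewrite /I lexx.
(* In degrees from [x] on, [e] agrees with the inclusion [u]. Lower degrees reduce to [x], since the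
   structure maps of [ideal_rep dI] into degree [x] are injective. *)
have e_inj t (w : ideal_rep dI t) : (x <= t)%O -> I t -> e t w = 0 -> w = 0.
  move=> xt It ew; have Jt : J t by rewrite /J xt.
  have iw : i t (const_mx (coef w)) = w by rewrite iE coef_const Jt coefK.
  have vt : tmap t v != 0 by rewrite -JE.
  have := eE t (const_mx (coef w)); rewrite iw ew uE coef_const Jt.
  by move/esym/eqP; rewrite scaler_eq0 (negPf vt) orbF coef_eq0 => /eqP.
apply/monomorphism_inj => t w ew.
have [It|z] := row_boolP k (I t); last exact: z.
have [xt|/ltW tx] := leP x t; first exact: e_inj ew.
have Ix : I x by rewrite /I lexx.
have /eqP : rep_map (ideal_rep dI) tx w = 0.
  by apply: e_inj => //; rewrite hom_nat ew raddf0.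
by rewrite irep_mapE -coef_eq0 coef_const Ix coef_eq0 => /eqP.
Qed.

Lemma injective_indecomposable_ideal E :
  injective_object E -> indecomposable E ->
  exists (I : pred T) (dI : down_closed I),
    (exists x, I x) /\ isomorphic E (ideal_rep dI).
Proof.
move=> Einj Edec; have [E0 _] := Edec.
have [I [dI [e [I0 emono]]]] := ideal_rep_embedding Einj E0.
exists I, dI; split=> //; apply: indecomposable_split emono _ Edec.
  exact: irep_injective.
exact/ideal_rep_nonzero.
Qed.

End Classification.

(** * Morphisms from finitely presented representations to those of ideals *)

Section FinitelyPresented.
Context (k : fieldType) {d : Order.disp_t} (T : orderType d).
Implicit Types (M N P C : rep k T) (I J : pred T) (x y t : T).

Local Notation ideal_rep dI := (irep k (down_closed_convex dI)).

Lemma dsum_inl M N : exists i : hom M (dsum M N), forall x v, i x v = (v, 0).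
Proof.
apply: build_hom => [x a u v|x y xy v].
  by congr pair; rewrite /= scaler0 addr0.
by rewrite /= /dsum_fun /= raddf0.
Qed.

Lemma dsum_inr M N : exists i : hom N (dsum M N), forall x v, i x v = (0, v).
Proof.
apply: build_hom => [x a u v|x y xy v].
  by congr pair; rewrite /= scaler0 addr0.
by rewrite /= /dsum_fun /= raddf0.
Qed.

Lemma hom_dsumE M N P (f : hom (dsum M N) P) :
  exists (f1 : hom M P) (f2 : hom N P),
    (forall x v, f1 x v = f x (v, 0)) /\ (forall x v, f2 x v = f x (0, v)).
Proof.
have [i iE] := dsum_inl M N; have [j jE] := dsum_inr M N.
have [f1 f1E] := Defs.hom_comp i f; have [f2 f2E] := Defs.hom_comp j f.
by exists f1, f2; split=> x v; rewrite ?f1E ?f2E ?iE ?jE.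
Qed.

Lemma hom_dsum_split M N P (f : hom (dsum M N) P) x (v : dsum M N x) :
  f x v = f x (v.1, 0) + f x (0, v.2).
Proof.
rewrite -raddfD; congr (f x _); case: v => v w.
by congr pair; rewrite /= ?addr0 ?add0r.
Qed.

(** The sum of representables is generated in the degrees [ys]. *)
Lemma hom_dsum_h_eq0 (ys : seq T) M (f : hom (dsum_h k ys) M) :
  (forall y, y \in ys -> forall w, f y w = 0) -> forall t v, f t v = 0.
Proof.
elim: ys f => [|y ys IH] f f0 t v.
  by rewrite (_ : v = 0) ?raddf0 // [LHS]thinmx0.
have [f1 [f2 [f1E f2E]]] := hom_dsumE (f : hom (dsum _ _) _).
rewrite (hom_dsum_split (f : hom (dsum _ _) _)) -f1E -f2E (IH f2) ?addr0.
  by rewrite hrep_homE f1E f0 ?mem_head // raddf0 scaler0.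
by move=> z zys w; rewrite f2E f0 // inE zys orbT.
Qed.

(* Projectivity of the left-hand side, for the epimorphism from the constant
   representation [k] to the representation of an ideal. *)
Lemma hom_dsum_h_lift (ys : seq T) I (dI : down_closed I)
    (f : hom (dsum_h k ys) (ideal_rep dI)) :
  exists l : forall t, dsum_h k ys t -> k,
    [/\ forall t, linear (l t : _ -> k^o),
        forall s t (st : (s <= t)%O) v, l t (rep_map (dsum_h k ys) st v) = l s v
      & forall t v, f t v = const_mx (l t v)].
Proof.
elim: ys f => [|y ys IH] f.
  exists (fun _ _ => 0); split=> // [t a u v|t v]; first by rewrite scaler0 addr0.
  by rewrite (_ : v = 0) ?raddf0 ?const_row0 // [LHS]thinmx0.
have [f1 [f2 [f1E f2E]]] := hom_dsumE (f : hom (dsum _ _) _).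
have [l [llin lnat lE]] := IH f2.
(* The coefficient of the image of the generator of [hrep k y]; the lift uses it in every degree,
   also outside [I]. *)
pose c := coef (f1 y (const_mx 1)).
exists (fun t (v : dsum (hrep k y) (dsum_h k ys) t) => coef v.1 * c + l t v.2); split.
- move=> t a [u u'] [v v'] /=; rewrite llin.
  rewrite (coef_is_linear a (u : 'rV_(y <= t)%O) v : coef (_ + _) = a * _ + _).
  by rewrite mulrDl scalerDr addrACA -mulrA.
- move=> s t st [v v']; rewrite -[LHS]/(coef (rep_map (hrep k y) st v) * c +
    l t (rep_map (dsum_h k ys) st v')) lnat hrep_mapE coef_const /=.
  have [ys_|z] := row_boolP k (y <= s)%O.
    by rewrite (le_trans ys_ st).
  by rewrite (z v) raddf0 mul0rn.
- move=> t v; rewrite (hom_dsum_split (f : hom (dsum _ _) _)) -f1E -f2E lE.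
  rewrite hrep_homE; have [yt|z] := row_boolP k (y <= t)%O; last first.
    by rewrite (z v.1) raddf0 scale0r mul0r !add0r.
  rewrite (tmapE yt) irep_mapE -/c.
  by apply/rowP => i; rewrite !mxE.
Qed.

(** Universal property of the cokernel: [e] applies [h] to a chosen preimage under [g], and the
    choice is immaterial since [h] kills the kernel of [g]. *)
Lemma hom_coker P Q C M (f : hom P Q) (g : hom Q C) (h : hom Q M) :
  (forall t v, g t v = 0 -> exists w, f t w = v) ->
  (forall t m, exists v, g t v = m) ->
  (forall t w, h t (f t w) = 0) ->
  exists e : hom C M, forall t v, e t (g t v) = h t v.
Proof.
move=> kg sg hf.
pose s t m := sval (cid (sg t m)).
have sK t m : g t (s t m) = m by rewrite /s; case: cid.
have hg t v w : g t v = g t w -> h t v = h t w.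
  move=> /eqP; rewrite -subr_eq0 -raddfB => /eqP/kg[u].
  move/(congr1 (h t)); rewrite hf raddfB => /esym/eqP.
  by rewrite subr_eq0 => /eqP.
have [x a u v|x y xy v|e eE] := @build_hom k d T C M (fun t m => h t (s t m)).
- by rewrite -linearP; apply: hg; rewrite linearP !sK.
- by rewrite -hom_nat; apply: hg; rewrite hom_nat !sK.
by exists e => t v; rewrite eE; apply: hg; rewrite sK.
Qed.

Lemma hom_ideal_open C I (dI : down_closed I) : finitely_presented C ->
  ~ hom_zero C (ideal_rep dI) ->
  exists x (ys : seq T), [/\ I x, forall y, y \in ys -> ~~ I y
    & forall J (dJ : down_closed J), J x -> (forall y, y \in ys -> ~~ J y) ->
        ~ hom_zero C (ideal_rep dJ)].
Proof.
move=> [zs [ys [f [g [kg sg]]]]] /existsNP[h /existsNP[t0 /existsNP[m0 hm0]]].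
have [hg hgE] := Defs.hom_comp g h.
have [l [llin lnat lE]] := hom_dsum_h_lift hg.
have [y [w [_ hgw0]]] : exists y w, y \in ys /\ hg y w <> 0.
  apply: contrapT => noyw; apply: hm0.
  have [v <-] := sg t0 m0; rewrite -hgE; apply: hom_dsum_h_eq0 => y yys w.
  by apply: contrapT => w0; apply: noyw; exists y, w.
have Iy : I y by have [//|z] := row_boolP k (I y); case: hgw0; exact: z.
have lw0 : l y w != 0.
  by apply: contra_notN hgw0 => /eqP lw; rewrite lE lw const_row0.
(* A generator degree where the morphism is nonzero, and the degrees of the relations outside
   [I]. *)
exists y, [seq z <- zs | ~~ I z]; split=> // [z|J dJ Jy nJ].
  by rewrite mem_filter => /andP[].
have [x Jx|s t st v Jt|p pE] :=
  @hom_to_irep k d T _ J (down_closed_convex dJ) l.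
- exact: llin.
- by rewrite lnat (dJ _ _ st Jt).
(* A relation whose degree lies in [J] also has its degree in [I], where [l] computes [hg], and [hg]
   kills relations. *)
have pf t v : p t (f t v) = 0.
  have [pf pfE] := Defs.hom_comp f p; rewrite -pfE.
  apply: hom_dsum_h_eq0 => z zzs u; rewrite pfE pE.
  have [Jz|z0] := row_boolP k (J z); last exact: z0.
  have Iz : I z.
    by apply: contraTT Jz => nIz; apply: nJ; rewrite mem_filter nIz.
  have : hg z (f z u) = 0.
    rewrite hgE (_ : g z (f z u) = 0) ?raddf0 //.
    by apply/kg; exists u.
  rewrite lE => /(congr1 (@coef k (I z))).
  rewrite coef_const raddf0 Iz => lz0.
  by rewrite (lz0 : l z (f z u) = 0) const_row0.
have [e eE] := hom_coker (fun t v => proj1 (kg t v)) sg pf.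
move=> /(_ e y (g y w)); rewrite eE pE => /(congr1 (@coef k (J y))).
by rewrite coef_const raddf0 Jy; apply/eqP.
Qed.

(** The generator of each [hrep k y] goes to the restriction of that of [hrep k x], so the image is
    everything in the degrees above some [y]. *)
Lemma hrep_relations x (ys : seq T) : (forall y, y \in ys -> (x <= y)%O) ->
  exists f : hom (dsum_h k ys) (hrep k x), forall t v,
    (exists w, f t w = v) <-> has (fun y => y <= t)%O ys \/ v = 0.
Proof.
elim: ys => [|y ys IH] xys.
  have [f fE] := zero_hom (zero_rep k T) (hrep k x).
  exists f => t v; split=> [[w <-]|[//|->]]; first by right; rewrite fE.
  by exists 0; rewrite fE.
have [z zys|f fE] := IH; first by apply: xys; rewrite inE zys orbT.
have xy : (x <= y)%O by apply: xys; exact: mem_head.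
have [h hE] := @hom_from_hrep k d T (hrep k x) y (const_mx 1).
have [g gE] : exists g : hom (dsum (hrep k y) (dsum_h k ys)) (hrep k x),
    forall t v, g t v = h t v.1 + f t v.2.
  apply: build_hom => [t a [u u'] [v v']|s t st [v v']].
    by rewrite /= !linearP scalerDr addrACA.
  rewrite -[LHS]/(h t (rep_map (hrep k y) st v) +
    f t (rep_map (dsum_h k ys) st v')) !hom_nat.
  exact: (esym (raddfD (rep_map (hrep k x) st) _ _)).
exists g => t v; split=> [[[w w'] /= <-]|].
  rewrite gE /=; have [yt|z] := row_boolP k (y <= t)%O; first by left; rewrite yt.
  rewrite (z w) raddf0 add0r.
  have /fE[ht|->] : exists w0, f t w0 = f t w' by exists w'.
    by left; rewrite ht orbT.
  by right.
have [yt|yt] : (y <= t)%O \/ ~~ (y <= t)%O by apply/orP; rewrite orbN.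
  move=> _.
  exists (const_mx (coef v), 0); rewrite gE /= raddf0 addr0 hE coef_const yt.
  rewrite (tmapE yt) hrep_mapE coef_const xy.
  rewrite -[RHS]coefK.
  by apply/rowP => i; rewrite !mxE mulr1.
move=> /= vP; have /fE[w <-] : has (fun y => y <= t)%O ys \/ v = 0.
  by move: vP; rewrite (negPf yt).
exists (0, w).
by rewrite gE /= raddf0 add0r.
Qed.

(** The cokernel of the morphism of [hrep_relations] is the interval representation of the degrees
    above [x] and above no [y]. *)
Lemma finitely_presented_interval x (ys : seq T) :
  (forall y, y \in ys -> (x <= y)%O) ->
  exists C, finitely_presented C /\
    forall J (dJ : down_closed J), ~ hom_zero C (ideal_rep dJ) <->
      J x /\ forall y, y \in ys -> ~~ J y.
Proof.
move=> xys; pose S t := (x <= t)%O && ~~ has (fun y => y <= t)%O ys.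
have cS : convex_pred S.
  move=> s t u st tu /andP[xs _] /andP[_ nu].
  rewrite /S (le_trans xs st); apply: contra nu => /hasP[y yys yt].
  by apply/hasP; exists y => //; exact: le_trans tu.
exists (irep k cS); split.
  have [f fE] := hrep_relations xys.
  have [g gE] : exists g : hom (dsum (hrep k x) (zero_rep k T)) (irep k cS),
      forall t v, g t v = const_mx (coef v.1).
    apply: (@hom_to_irep k d T _ S cS
      (fun t (v : dsum (hrep k x) (zero_rep k T) t) => coef v.1))
      => [t St a u v|s t st [v v'] /andP[xt /hasPn nt]].
      exact: coef_is_linear.
    rewrite -[LHS]/(coef (rep_map (hrep k x) st v)) hrep_mapE coef_const xt /=.
    have [xs|z] := row_boolP k (x <= s)%O; last by rewrite (z v) raddf0 !mul0rn.
    rewrite /=; move: (coef v) => c; rewrite /S xs; case: hasP => // -[y yys ys_].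
    by have := nt y yys; rewrite (le_trans ys_ st).
  have [i iE] := dsum_inl (hrep k x) (zero_rep k T).
  have [fi fiE] := Defs.hom_comp f i.
  exists ys, [:: x], fi, g; split=> [t [v v']|t m].
    rewrite gE; have -> : v' = 0 by rewrite [LHS]thinmx0.
    split=> /= [v0|[w]].
      suff /fE[w wE] : has (fun y => y <= t)%O ys \/ v = 0.
        by exists w; rewrite fiE wE iE.
      have [|nt] := boolP (has _ _); [by left|right].
      have [xt|z] := row_boolP k (x <= t)%O; last exact: z.
      have St : S t by rewrite /S xt.
      move: v0 => /(congr1 (@coef k (S t))); rewrite coef_const raddf0 St.
      by move/eqP; rewrite coef_eq0 => /eqP.
    rewrite fiE iE => -[fwv]; have : exists w, f t w = v by exists w.
    move=> /fE[ht|->]; last by rewrite raddf0 const_row0.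
    have [|z] := row_boolP k (S t); last exact: z.
    by rewrite /S ht andbF.
  exists (const_mx (coef m), 0); rewrite gE /= coef_const.
  have [/andP[xt _]|z] := row_boolP k (S t); last by rewrite [LHS]z [RHS]z.
  by rewrite xt coefK.
move=> J dJ; split=> [/existsNP[f /existsNP[t /existsNP[v fv0]]]|[Jx nJ] h0].
  have Jt : J t by have [//|z] := row_boolP k (J t); case: fv0; exact: z.
  have /andP[xt /hasPn nt] : S t.
    have [//|z] := row_boolP k (S t); case: fv0.
    by rewrite (z v) raddf0.
  split; first exact: (dJ _ _ xt Jt).
  (* If [y] were in [J], restriction from [t] to [y] would be injective on the target, yet zero on
     the source because [y] is outside [S]. *)
  move=> y yys; apply/negP => Jy.
  have ty : (t <= y)%O by rewrite ltW // ltNge nt.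
  apply: fv0; have : rep_map (ideal_rep dJ) ty (f t v) = 0.
    rewrite -hom_nat; have [/andP[_ /hasPn/(_ y yys)]|z] := row_boolP k (S y).
      by rewrite lexx.
    by rewrite (_ : rep_map _ _ _ = 0) ?raddf0 //; exact: z.
  rewrite irep_mapE => /(congr1 (@coef k (J y))); rewrite coef_const raddf0 Jy.
  by move/eqP; rewrite coef_eq0 => /eqP.
(* The identity of $k$ in common degrees; it is natural because every element of [J] above [x] lies
   in [S]. *)
have [f fE] : exists f : hom (irep k cS) (ideal_rep dJ),
    forall t v, f t v = const_mx (coef v).
  apply: hom_to_irep => [t _|s t st v Jt]; first exact: coef_is_linear.
  rewrite irep_mapE coef_const (dJ _ _ st Jt).
  have [/andP[xs _]|z] := row_boolP k (S s); last by rewrite (z v) raddf0 !mul0rn.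
  move: (coef v) => c; rewrite /S (le_trans xs st) /=; case: hasP => // -[y yys yt].
  by have := nJ y yys; rewrite (dJ _ _ yt Jt).
have := h0 f x (const_mx 1); rewrite fE coef_const => /(congr1 (@coef k (J x))).
rewrite coef_const raddf0 Jx /S lexx /=; case: hasP => [[y yys yx] _|_ /eqP].
  by have := nJ y yys; rewrite (dJ _ _ yx Jx).
by rewrite oner_eq0.
Qed.

End FinitelyPresented.

(** * A base of the order topology on ideals *)

Section IdealTopology.
Context {d : Order.disp_t} (T : orderType d).
Implicit Types (I J : Idl T) (x y : T).
Local Open Scope classical_set_scope.

Lemma idl_inj I J : idl_set I = idl_set J -> I = J.
Proof.
by move=> IJ; apply/le_anti/andP; split; apply/asboolP; rewrite IJ.
Qed.

Lemma idl_ltP I J : reflect (exists2 x, idl_set J x & ~ idl_set I x) (I < J)%O.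
Proof.
rewrite ltNge; apply: (iffP idP) => [/asboolP/existsNP[x /not_implyP[Jx nIx]]|].
  by exists x.
by move=> [x Jx nIx]; apply/asboolPn => JI; exact/nIx/JI.
Qed.

(** An ideal contains [x] exactly when it is strictly larger than the set of elements below [x]. *)
Lemma nbhs_idl_mem I x :
  idl_set I x -> nbhs (I : order_topology (Idl T)) [set J | idl_set J x].
Proof.
move=> Ix; have [[y yx]|min] := pselect (exists y, (y < x)%O).
  have idA : is_ideal [set z | (z < x)%O].
    by split; [exists y|move=> z w zw /= wx; exact: le_lt_trans wx].
  pose A : order_topology (Idl T) := MkIdl idA.
  have AI : (A < I)%O by apply/idl_ltP; exists x; rewrite /= ?ltxx.
  have : nbhs (I : order_topology (Idl T)) `]A, +oo[.
    by apply: open_nbhs_nbhs; split; [exact: rray_open|rewrite set_itvE].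
  apply: filterS => J; rewrite set_itvE => /idl_ltP[z Jz /= /negP].
  rewrite -leNgt => xz.
  by have [_ dJ] := idl_prop J; exact: dJ Jz.
(* For a least [x] that set is empty, hence no ideal, but then every ideal contains [x]. *)
apply: filterS filterT => J _; have [[z Jz] dJ] := idl_prop J.
apply: dJ Jz; rewrite leNgt; apply/negP => zx; by apply: min; exists z.
Qed.

(** An ideal avoids [y] exactly when it is strictly smaller than the principal ideal of [y]. *)
Lemma nbhs_idl_notin I y :
  ~ idl_set I y -> nbhs (I : order_topology (Idl T)) [set J | ~ idl_set J y].
Proof.
move=> nIy; have idA : is_ideal [set z | (z <= y)%O].
  by split; [exists y => /=|move=> z w zw /=; exact: le_trans].
pose A : order_topology (Idl T) := MkIdl idA.
have AI : (I < A)%O by apply/idl_ltP; exists y; rewrite /= ?lexx.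
have : nbhs (I : order_topology (Idl T)) `]-oo, A[.
  by apply: open_nbhs_nbhs; split; [exact: lray_open|rewrite set_itvE].
apply: filterS => J; rewrite set_itvE => /idl_ltP[z /= zy nJz] Jy.
by have [_ dJ] := idl_prop J; exact/nJz/(dJ _ _ zy).
Qed.

Lemma idl_openP (V : set (Idl T)) : idl_open V <->
  forall I, V I -> exists x (ys : seq T),
    [/\ idl_set I x, forall y, y \in ys -> ~ idl_set I y
    & forall J, idl_set J x -> (forall y, y \in ys -> ~ idl_set J y) -> V J].
Proof.
split=> [oV I VI|HV].
  have : nbhs (I : order_topology (Idl T)) V by exact: open_nbhs_nbhs.
  rewrite itv_nbhsE => -[[l r] [lr Ilr] lrV].
  have [lE rE] : ((exists A, l = BRight A) \/ l = -oo%O) /\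
      ((exists B, r = BLeft B) \/ r = +oo%O).
    move: lr Ilr; rewrite itv_boundlr => + /andP[+ +].
    case: l r {lrV} => [[] A|[]] [[] B|[]] //= _ _ _;
      by split; try (by right); left; eexists.
  (* A lower end [A] yields an element of [I] outside [A]; without a lower end any element of the
     nonempty [I] serves. *)
  have [x [Ix xl]] : exists x, idl_set I x /\
      forall J, idl_set J x -> (l <= BLeft J)%O.
    move: Ilr; rewrite itv_boundlr => /andP[+ _].
    have [[A ->]|-> _] := lE; last first.
      by have [[x Ix] _] := idl_prop I; exists x; split=> // J _; rewrite bnd_simp.
    rewrite bnd_simp => /idl_ltP[x Ix nAx]; exists x; split=> // J Jx.
    by rewrite bnd_simp; apply/idl_ltP; exists x.
  (* An upper end [B] yields one element of [B] outside [I]; without an upper end the list is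
     empty. *)
  have [ys [Iys ysr]] : exists ys : seq T,
      (forall y, y \in ys -> ~ idl_set I y) /\
      forall J, (forall y, y \in ys -> ~ idl_set J y) -> (BRight J <= r)%O.
    move: Ilr; rewrite itv_boundlr => /andP[_ +].
    have [[B ->]|-> _] := rE; last by exists [::]; split=> // J _; rewrite bnd_simp.
    rewrite bnd_simp => /idl_ltP[y By nIy]; exists [:: y]; split=> [z|J Jy].
      by rewrite inE => /eqP ->.
    by rewrite bnd_simp; apply/idl_ltP; exists y => //; apply: Jy; exact: mem_head.
  exists x, ys; split=> // J Jx Jys; apply: lrV.
  by rewrite /= itv_boundlr xl // ysr.
rewrite /idl_open openE => I /HV[x [ys [Ix Iys sV]]].
have : nbhs (I : order_topology (Idl T))
    [set J | forall y, y \in ys -> ~ idl_set J y].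
  elim: ys Iys {sV} => [|y ys IH] Iys; first by apply: filterS filterT.
  have Iy : ~ idl_set I y by apply: Iys; exact: mem_head.
  have {}IH := IH (fun z zys => Iys z (mem_behead (s := y :: ys) zys)).
  apply: filterS (filterI (nbhs_idl_notin Iy) IH) => J [nJy nJ] z.
  by rewrite inE => /predU1P[->|/nJ].
move=> /(filterI (nbhs_idl_mem Ix)); apply: filterS => J [Jx Jys].
exact: sV.
Qed.

End IdealTopology.

(** * Transfer from boolean predicates to [Idl T], and Ziegler-open sets *)

Section IdealRepresentations.
Context (k : fieldType) {d : Order.disp_t} (T : orderType d).
Implicit Types (I J : Idl T) (M N C : rep k T).

Definition idl_mem I : pred T := fun x => `[< idl_set I x >].

Lemma idl_mem_down I : down_closed (idl_mem I).
Proof.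
move=> x y xy /asboolP Iy; apply/asboolP.
by have [_ dI] := idl_prop I; exact: dI Iy.
Qed.

Definition idl_rep I : rep k T := irep k (down_closed_convex (@idl_mem_down I)).

Lemma idl_mem_nonempty I : exists x, idl_mem I x.
Proof. by have [[x Ix] _] := idl_prop I; exists x; apply/asboolP. Qed.

Lemma idl_rep_inj I J : isomorphic (idl_rep I) (idl_rep J) -> I = J.
Proof.
move=> IJ; apply: idl_inj; apply/seteqP; split=> x /asboolP Hx; apply/asboolP.
  exact: (ideal_rep_iso_sub IJ).
exact: (ideal_rep_iso_sub (isomorphic_sym IJ)).
Qed.

Lemma injective_indecomposable_idl M : indecomposable M -> injective_object M ->
  exists I, isomorphic M (idl_rep I).
Proof.
move=> Mdec Minj.
have [P [dP [P0 MP]]] := injective_indecomposable_ideal Minj Mdec.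
have P_ideal : is_ideal [set x | P x] by split.
exists (MkIdl P_ideal).
suff PE : idl_mem (MkIdl P_ideal) = P.
  rewrite /idl_rep; move: (@idl_mem_down (MkIdl P_ideal)); rewrite PE => dP'.
  by rewrite (Prop_irrelevance dP' dP).
by apply/funext => x; apply/asboolP/idP.
Qed.

Lemma hom_zero_iso C M N : isomorphic M N -> hom_zero C M -> hom_zero C N.
Proof.
move=> [f [g fg]] CM h x v; have [_ gK] := fg x.
have [e eE] := Defs.hom_comp h g.
by rewrite -[h x v]gK -eE CM raddf0.
Qed.

Lemma hom_idl_open C I : finitely_presented C -> ~ hom_zero C (idl_rep I) ->
  exists x (ys : seq T), [/\ idl_set I x, forall y, y \in ys -> ~ idl_set I y
    & forall J, idl_set J x -> (forall y, y \in ys -> ~ idl_set J y) ->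
        ~ hom_zero C (idl_rep J)].
Proof.
move=> Cfp /(hom_ideal_open Cfp)[x [ys [/asboolP Ix nI HJ]]].
exists x, ys; split=> // [y /nI/asboolPn //|J Jx nJ].
by apply: HJ => [|y yys]; [apply/asboolP|apply/asboolPn; exact: nJ].
Qed.

(** The ideal [I] separates [x] from [ys], which forces [x <= y] for every [y] in the list. *)
Lemma finitely_presented_idl_interval I x (ys : seq T) :
  idl_set I x -> (forall y, y \in ys -> ~ idl_set I y) ->
  exists C, finitely_presented C /\
    forall J, ~ hom_zero C (idl_rep J) <->
      idl_set J x /\ forall y, y \in ys -> ~ idl_set J y.
Proof.
move=> Ix nI; have [y yys|C [Cfp CE]] := @finitely_presented_interval k d T x ys.
  rewrite leNgt; apply/negP => /ltW yx; apply: (nI y yys).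
  by have [_ dI] := idl_prop I; exact: dI Ix.
exists C; split=> // J; rewrite CE; split=> -[Jx nJ].
  by split=> [|y /nJ/asboolPn //]; apply/asboolP.
by split=> [|y yys]; [apply/asboolP|apply/asboolPn; exact: nJ].
Qed.

(** A point is outside the closure of the complement of [U] exactly when some [C] in the left
    perpendicular of that complement maps nontrivially to it. *)
Lemma ziegler_openP (Sp : rep k T -> Prop) (U : {X : rep k T | Sp X} -> Prop) :
  ziegler_open U <-> forall X, U X -> exists C, [/\ finitely_presented C,
    ~ hom_zero C (sval X) & forall Y, ~ U Y -> hom_zero C (sval Y)].
Proof.
split=> [Uo X UX|HU X].
  apply: contrapT => noC; have [+ _] := Uo X; apply=> // C [Cfp CU].
  by apply: contrapT => CX; apply: noC; exists C.
split=> [XU UX|nUX C [_]]; last exact.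
by have [C [Cfp CX CU]] := HU X UX; apply/CX/XU.
Qed.

End IdealRepresentations.

(** * The bijection between spectrum and ideals, and the comparison of open sets *)

Theorem theorem1p1 (k : fieldType) (d : Order.disp_t) (T : orderType d)
    (Sp : rep k T -> Prop) (hSp : spectrum Sp) :
  exists f : {X : rep k T | Sp X} -> Idl T,
    homeomorphism (@ziegler_open k d T Sp) (@idl_open d T) f.
Proof.
have [SpI Sprep Spuniq] := hSp.
have ideal_of (X : {X | Sp X}) :
  exists I : Idl T, isomorphic (sval X) (idl_rep k I).
  by have [] := SpI _ (svalP X); exact: injective_indecomposable_idl.
have rep_of (I : Idl T) :
  exists X : {X | Sp X}, isomorphic (idl_rep k I) (sval X).
  have [||N [SpN IN]] := Sprep (idl_rep k I).
  - exact/ideal_rep_indecomposable/idl_mem_nonempty.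
  - exact: irep_injective.
  by exists (exist _ N SpN).
have [f fE] : exists f : {X | Sp X} -> Idl T,
    forall X, isomorphic (sval X) (idl_rep k (f X)).
  by exists (fun X => sval (cid (ideal_of X))) => X; case: cid.
have [g gE] : exists g : Idl T -> {X | Sp X},
    forall I, isomorphic (idl_rep k I) (sval (g I)).
  by exists (fun I => sval (cid (rep_of I))) => I; case: cid.
have gK : cancel g f.
  move=> I; apply/esym/(@idl_rep_inj k); exact: isomorphic_trans (gE I) (fE _).
(* The spectrum has one representative per isomorphism class, so isomorphic points are equal. *)
have fK : cancel f g.
  move=> X; apply: eq_sig_hprop => [Y|]; first exact: Prop_irrelevance.
  apply: Spuniq; [exact: svalP|exact: svalP|].
  exact/isomorphic_sym/(isomorphic_trans (fE X) (gE _)).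
have fhom C X : hom_zero C (sval X) <-> hom_zero C (idl_rep k (f X)).
  by split; apply: hom_zero_iso; [exact: fE|exact/isomorphic_sym/fE].
(* This yields both continuity and openness of [f]: for openness [V] is the image of [U], whose
   preimage is [U] by injectivity. *)
have openE (V : Idl T -> Prop) : idl_open V <-> ziegler_open (fun X => V (f X)).
  rewrite idl_openP ziegler_openP; split=> [HV X VX|HV I VI].
    have [x [ys [Ix nI sV]]] := HV _ VX.
    have [C [Cfp CE]] := finitely_presented_idl_interval k Ix nI.
    exists C; split=> // [/fhom|Y nVY]; first exact/CE.
    apply: contrapT => CY; apply: nVY.
    have /CE[] : ~ hom_zero C (idl_rep k (f Y)) by move=> /fhom.
    exact: sV.
  have [C [Cfp CI CV]] := HV (g I) (eq_ind_r V VI (gK I)).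
  have [|x [ys [Ix nI sC]]] := hom_idl_open (I := I) Cfp.
    by rewrite -[I]gK => /fhom.
  exists x, ys; split=> // J Jx nJ; apply: contrapT => nVJ.
  by apply: (sC J Jx nJ); rewrite -[J]gK; apply/fhom/CV; rewrite gK.
exists f; split=> [|V /openE //|U Uo]; first by exists g.
apply/openE; suff <- : U = fun X => exists2 Y, U Y & f Y = f X by [].
apply/funext => X; apply/propext; split=> [UX|[Y UY /(can_inj fK) <-//]].
by exists X.
Qed.
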